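(* If $\mathcal S=(\mathcal P,\mathcal L)$ is a finite thick generalized quadrangle and $G$ is an automorphism group of $\mathcal S$ acting primitively on $\mathcal P$, then the action of $G$ on $\mathcal P$ is not of O'Nan–Scott type HS.
   Context: A finite generalized quadrangle of order $(s,t)$ is a point-line incidence structure whose incidence graph is bipartite of diameter $4$ and girth $8$, with $s+1$ points per line and $t+1$ lines per point; thick means $s,t\ge2$. A primitive group $G$ has O'Nan–Scott type HS (holomorph simple) if $\mathrm{soc}(G)=T\times T$ for a nonabelian simple group $T$, the two factors $T\times1$ and $1\times T$ are minimal normal subgroups of $G$ acting regularly, and the stabilizer of a point in $\mathrm{soc}(G)$ is the diagonal subgroup $\{(x,x):x\in T\}$. *)

(* Defs.v *)
From HB Require Import structures.
From mathcomp Require Import all_boot all_fingroup all_solvable.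

Set Implicit Arguments.
Unset Strict Implicit.
Unset Printing Implicit Defensive.

Local Open Scope group_scope.

Section FiniteGraphs.

Variables (V : finType) (e : rel V).

Definition has_walk (x y : V) (n : nat) : Prop :=
  exists p : seq V, [/\ path e x p, last x p = y & size p = n].

Definition is_dist (x y : V) (n : nat) : Prop :=
  has_walk x y n /\ forall m, has_walk x y m -> n <= m.

Definition has_diameter (d : nat) : Prop :=
  (forall x y, exists2 n, is_dist x y n & n <= d) /\
  (exists x y, is_dist x y d).

(* The bound [2 < size c] excludes the degenerate closed walks x - y - x,
   which [ucycle] would otherwise accept. *)
Definition is_graph_cycle (c : seq V) : Prop := 2 < size c /\ ucycle e c.

Definition has_girth (g : nat) : Prop :=
  (exists2 c, is_graph_cycle c & size c = g) /\
  (forall c, is_graph_cycle c -> g <= size c).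

End FiniteGraphs.

Section IncidenceStructures.

Variables (P L : finType) (I : P -> L -> bool).

Definition incidence_graph : rel (P + L) := fun u v =>
  match u, v with
  | inl p, inr l => I p l
  | inr l, inl p => I p l
  | _, _ => false
  end.

Definition generalized_quadrangle (s t : nat) : Prop :=
  [/\ has_diameter incidence_graph 4,
      has_girth incidence_graph 8,
      forall l : L, #|[set p | I p l]| = s.+1
    & forall p : P, #|[set l | I p l]| = t.+1].

(* An automorphism is a permutation of the points together with a permutation
   of the lines, jointly preserving incidence. *)
Definition Aut_incidence : {set {perm P} * {perm L}} :=
  [set g : {perm P} * {perm L} | [forall p, forall l, I (g.1 p) (g.2 l) == I p l]].

Lemma Aut_incidence_group_set : group_set Aut_incidence.
Proof.
apply/group_setP; split=> [|g h].
  by rewrite inE; apply/forallP=> p; apply/forallP=> l; rewrite !perm1.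
rewrite !inE => /forallP gP /forallP hP.
apply/forallP=> p; apply/forallP=> l; rewrite /= !permM.
by rewrite (eqP (forallP (hP _) _)) (forallP (gP _)).
Qed.

Canonical Aut_incidence_group := Group Aut_incidence_group_set.

(* The permutation group on the points induced by a group of automorphisms. *)
Definition on_points (G : {group {perm P} * {perm L}}) : {group {perm P}} :=
  (@fst {perm P} {perm L} @* G)%G.

End IncidenceStructures.

Section ONanScottHS.

(* [minnormal N G] by itself does not require N to be contained in G. *)
Definition min_normal_subgroup (gT : finGroupType) (G N : {set gT}) : bool :=
  minnormal N G && (N <| G).

Definition socle (gT : finGroupType) (G : {set gT}) : {set gT} :=
  << \bigcup_(N : {group gT} | min_normal_subgroup G N) N >>.

Variable Omega : finType.

Definition acts_regularly (H : {set {perm Omega}}) : Prop :=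
  [transitive H, on [set: Omega] | 'P] /\
  forall x : Omega, 'C_H[x | 'P] = 1.

(* The isomorphism [f] identifies T x T with the socle. For a fixed [f] only
   particular points have the diagonal itself, rather than a twisted diagonal
   {(x, x ^ a)}, as their stabilizer: hence [exists omega]. *)
Definition type_HS (G : {group {perm Omega}}) : Prop :=
  exists (gT : finGroupType) (T : {group gT})
         (f : {morphism setX T T >-> {perm Omega}}),
  [/\ simple T /\ ~~ abelian T,
      isom (setX T T) (socle G) f,
      min_normal_subgroup G (f @* setX T 1) /\
        min_normal_subgroup G (f @* setX 1 T),
      acts_regularly (f @* setX T 1) /\ acts_regularly (f @* setX 1 T)
    & exists omega : Omega,
        'C_(socle G)[omega | 'P] = f @* [set (x, x) | x in T]].

End ONanScottHS.

(* Main.v *)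
(* If the action had type HS, T x T would act on the points, identified with T,
   by z |-> y^-1 * z * x.  Let l be a line through 1 and let g be a point of l.
   For z on l other than 1 and g, the points z, g and z * g are pairwise
   collinear, hence on a common line, and so l * g = l: the lines through 1 are
   subgroups of order s + 1, and all lines are their cosets.

   Fix such a subgroup A.  Every x in T is a * b with a in A and b in a line
   subgroup B, and a is unique when x is not in A.  Applied to
   a * b = (a ^ b) * (b ^ (a ^ b)), uniqueness shows that an element of B <> A
   normalising A centralises it.  Hence 'N_T(A) is the product of A with the k
   line subgroups centralising it, and |'N_T(A)| = (s + 1)(1 + s k).  As A has at
   most t + 1 conjugates, k > 0; if B centralises A then A * B is a subgroup, so
   s + 1 divides 1 + s k.  Since A is not normal, t <= s^2 (Higman) leaves only
   k = 1, so every conjugacy class of line subgroups has 1 + s u members, where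
   1 + s t = (s + 1)(1 + s u).  But 1 + s u does not divide
   t + 1 = (1 + s u) + (u + 1), the total number of line subgroups. *)
Require Import Defs.
From mathcomp Require Import all_boot all_fingroup all_solvable.
From mathcomp Require Import zify ring.

Set Implicit Arguments.
Unset Strict Implicit.
Unset Printing Implicit Defensive.

(** * Sums against indicator functions *)

Lemma sum_pred1_mul (T : finType) (x : T) (F : T -> nat) :
  \sum_y (y == x) * F y = F x.
Proof. by rewrite (bigD1 x) //= eqxx mul1n big1 ?addn0 // => y /negPf->. Qed.

Lemma sum_pred1 (T : finType) (x : T) : \sum_y (y == x : nat) = 1.
Proof. by rewrite -(sum_pred1_mul x (fun=> 1)); apply: eq_bigr => y; rewrite muln1. Qed.

(** * Collinearity in a generalized quadrangle *)

Section QuadrangleAxioms.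

Variables (P L : finType) (I : P -> L -> bool) (s t : nat).
Hypothesis gq : generalized_quadrangle I s t.

Let short_cycle_false c :
  size c < 8 -> 2 < size c -> ucycle (incidence_graph I) c -> False.
Proof.
case: gq => _ [_ girth] _ _ lt8 gt2 cc.
by have := girth c (conj gt2 cc); rewrite leqNgt lt8.
Qed.

Lemma gq_line_unique p q l m :
  p != q -> I p l -> I q l -> I p m -> I q m -> l = m.
Proof.
move=> pq pl ql pm qm; apply/eqP; apply: contraT => lm; exfalso.
apply: (@short_cycle_false [:: inl p; inr l; inl q; inr m]) => //.
rewrite /ucycle /= pl ql qm pm /= !inE /=.
rewrite ?(inj_eq inl_inj) ?(inj_eq inr_inj).
by rewrite negb_or pq lm.
Qed.

(** If [l] and [m] differed, then [p], [l], [q], [m], [r], [n] would be a cycle of length 6, below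
    the girth. *)
Lemma gq_no_triangle p q r l m n :
  p != q -> q != r -> p != r ->
  I p l -> I q l -> I q m -> I r m -> I r n -> I p n -> l = m.
Proof.
move=> pq qr pr pl ql qm rm rn pn; apply/eqP; apply: contraT => lm; exfalso.
have ln : l != n.
  by apply: contraNneq lm => e; rewrite (gq_line_unique qr ql _ qm rm) // e.
have mn : m != n.
  by apply: contraNneq lm => e; rewrite (gq_line_unique pq pl ql _ qm) // e.
apply: (@short_cycle_false [:: inl p; inr l; inl q; inr m; inl r; inr n]) => //.
rewrite /ucycle /= pl ql qm rm rn pn /= !inE /=.
rewrite ?(inj_eq inl_inj) ?(inj_eq inr_inj).
by rewrite !negb_or /= pq pr lm ln qr mn.
Qed.

(** A walk from a point to a line has odd length; by the diameter one of length 1 or 3 exists, and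
    length 1 would be incidence. *)
Lemma gq_projection p l :
  ~~ I p l -> exists q m, [/\ I q l, I p m & I q m].
Proof.
case: gq => -[diam _] _ _ _ npl.
have [n [[w [pw lw sw]] _] n4] := diam (inl p) (inr l).
case: w pw lw sw => [|[?|m] [|[q|?] w]] //=; try by rewrite ?andbF.
  by rewrite andbT => pm [ml]; rewrite -ml pm in npl.
case: w => [|[?|m'] [|[r|?] [|? w]]] //=; try by rewrite !andbF.
  by rewrite andbT => /and3P[pm qm qm'] [<-] _; exists q, m.
by move=> _ _ sw; move: n4; rewrite -sw.
Qed.

Lemma sum_points_line l : \sum_p (I p l : nat) = s.+1.
Proof.
by case: gq => _ _ cl _; rewrite -(cl l) -sum1dep_card [RHS]big_mkcond.
Qed.

Lemma sum_lines_point p : \sum_l (I p l : nat) = t.+1.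
Proof.
by case: gq => _ _ _ cp; rewrite -(cp p) -sum1dep_card [RHS]big_mkcond.
Qed.

Definition collinear p q := (p != q) && [exists l, I p l && I q l].

Lemma collinearxx p : collinear p p = false.
Proof. by rewrite /collinear eqxx. Qed.

Lemma collinear_sym p q : collinear p q = collinear q p.
Proof.
by rewrite /collinear eq_sym; congr (_ && _); apply: eq_existsb => l; rewrite andbC.
Qed.

(** An entry of [N * N^T = A + (t + 1) * Id], for the incidence matrix [N] and the collinearity
    matrix [A]. Booleans count as 0 and 1, so double counting becomes an exchange of sums. *)
Lemma sum_common_lines p q :
  \sum_l (I p l * I q l) = collinear p q + t.+1 * (p == q).
Proof.
have [<-|pq] := eqVneq p q.
  rewrite collinearxx muln1 -(sum_lines_point p); apply: eq_bigr => l _.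
  by case: (I p l).
rewrite muln0 addn0 /collinear pq /=.
have [/existsP[l /andP[pl ql]]|/existsPn nl] := boolP [exists l, I p l && I q l].
  rewrite (bigD1 l) //= pl ql big1 ?addn0 // => m ml.
  case pm: (I p m); case qm: (I q m) => //.
  by rewrite (gq_line_unique pq pl ql pm qm) eqxx in ml.
by rewrite big1 // => l _; move: (nl l); case: (I p l); case: (I q l).
Qed.

(** Off [l], the point [p] has exactly one neighbour on [l], its projection; on [l], the other [s]
    points are its neighbours. The term [I p l] on the left avoids [s - 1]. *)
Lemma sum_collinear_line p l :
  \sum_q (collinear p q * I q l) + I p l = 1 + s * I p l.
Proof.
case pl: (I p l).
  rewrite muln1 add1n -(sum_points_line l) [in RHS](bigD1 p) //= pl addnC.
  rewrite (bigD1 p) //= collinearxx add0n; congr (1 + _).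
  apply: eq_bigr => q qp; rewrite /collinear eq_sym qp /=.
  case ql: (I q l); last by rewrite muln0.
  rewrite (_ : [exists m, I p m && I q m]) //.
  by apply/existsP; exists l; rewrite pl ql.
have [q [m [ql pm qm]]] := gq_projection (negbT pl).
have pq : p != q by apply: contraFneq pl => ->.
rewrite muln0 !addn0 (bigD1 q) //= ql big1 => [|r rq].
  rewrite /collinear pq (_ : [exists l, I p l && I q l]) //.
  by apply/existsP; exists m; rewrite pm.
case rl: (I r l); last by rewrite muln0.
case pr: (collinear p r) => //; case/andP: pr => pr /existsP[n /andP[pn rn]].
have ml : m = l by apply: (gq_no_triangle pq _ pr pm qm ql rl rn pn); rewrite eq_sym.
by rewrite -ml pm in pl.
Qed.

Lemma sum_collinear p : \sum_q (collinear p q : nat) = s * t.+1.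
Proof.
have : \sum_l \sum_q (I p l * I q l) = t.+1 * s.+1.
  under eq_bigr => l _ do rewrite -big_distrr /= sum_points_line.
  by rewrite -big_distrl /= sum_lines_point.
rewrite exchange_big /=; under eq_bigr => q _ do rewrite sum_common_lines eq_sym.
rewrite big_split -big_distrr /= sum_pred1; lia.
Qed.

Lemma gq_point_count : P -> #|P| = s.+1 * (s * t).+1.
Proof.
move=> p0; have [l _] : exists l, I p0 l.
  apply/existsP; apply: contraT => /existsPn none.
  by have := sum_lines_point p0; rewrite big1 // => l _; rewrite (negPf (none l)).
have : \sum_p (\sum_q (collinear p q * I q l) + I p l) =
    \sum_p (1 + s * I p l) by apply: eq_bigr => p _; rewrite sum_collinear_line.
have -> : #|P| = \sum_(p : P) 1 by rewrite sum1_card.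
rewrite !big_split /= -big_distrr /= sum_points_line exchange_big /=.
under eq_bigr => q _.
  under eq_bigr => p _ do rewrite collinear_sym.
  rewrite -big_distrl /= sum_collinear; over.
by rewrite /= -big_distrr /= sum_points_line; lia.
Qed.

(** Strong regularity without subtraction: [s - 1] common neighbours for collinear points, [t + 1]
    otherwise. Sum [sum_collinear_line] over the lines through [y]. *)
Lemma sum_collinear2 x y : x != y ->
  \sum_z (collinear x z * collinear y z) + t.+2 * collinear x y =
    t.+1 + s * collinear x y.
Proof.
move=> xy.
have : \sum_l I y l * (\sum_q (collinear x q * I q l) + I x l) =
       \sum_l I y l * (1 + s * I x l).
  by apply: eq_bigr => l _; rewrite sum_collinear_line.
under eq_bigr => l _ do rewrite mulnDr big_distrr /=.
under [RHS]eq_bigr => l _ do rewrite mulnDr muln1 mulnCA.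
rewrite !big_split /= -big_distrr /= sum_lines_point sum_common_lines.
rewrite eq_sym (negPf xy) muln0 addn0 [collinear y x]collinear_sym => <-.
rewrite exchange_big /=.
under [in RHS]eq_bigr => z _.
  under eq_bigr => l _ do rewrite mulnCA.
  rewrite -big_distrr /= sum_common_lines mulnDr mulnCA; over.
under [in RHS]eq_bigr => z _ do rewrite /= eq_sym [_ * (z == y)]mulnC.
by rewrite big_split /= -big_distrr /= sum_pred1_mul; ring.
Qed.

Lemma collinear_triple p q r : collinear p q -> collinear q r -> collinear p r ->
  exists l, [/\ I p l, I q l & I r l].
Proof.
move=> /andP[pq /existsP[l /andP[pl ql]]] /andP[qr /existsP[m /andP[qm rm]]].
move=> /andP[pr /existsP[n /andP[pn rn]]].
by exists l; rewrite {3}(gq_no_triangle pq qr pr pl ql qm rm rn pn).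
Qed.

Lemma collinear_no_diamond x y c d : collinear c d ->
  collinear x c -> collinear x d -> collinear y c -> collinear y d ->
  x != y -> collinear x y.
Proof.
move=> cd xc xd yc yd xy.
have [l [xl cl dl]] := collinear_triple xc cd xd.
have [m [ym cm dm]] := collinear_triple yc cd yd.
have lm : l = m by case/andP: cd => cd _; apply: gq_line_unique cd _ _ _ _.
by rewrite /collinear xy; apply/existsP; exists l; rewrite xl lm ym.
Qed.

(** * Higman's inequality *)

Hypotheses (s_gt1 : 1 < s) (t_gt1 : 1 < t).

Section NonCollinearPair.

Variables x y : P.
Hypotheses (xy : x != y) (xNy : ~~ collinear x y).

Let far z := [&& x != z, y != z, ~~ collinear x z & ~~ collinear y z].
Let mid c := collinear x c && collinear y c.

Let card_mid : \sum_c (mid c : nat) = t.+1.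
Proof.
have := sum_collinear2 xy; rewrite (negPf xNy) !muln0 !addn0 => <-.
by apply: eq_bigr => z _; rewrite mulnb.
Qed.

(** Inclusion-exclusion over the neighbours of [x] and of [y], whose overlap is [mid]. *)
Let card_far : \sum_z (far z : nat) + 2 + 2 * (s * t.+1) = #|P| + t.+1.
Proof.
have sum1P : \sum_(z : P) 1 = #|P| by rewrite sum1_card.
suff : \sum_z (far z : nat) + \sum_z (z == x : nat) + \sum_z (z == y : nat) +
    \sum_z (collinear x z : nat) + \sum_z (collinear y z : nat) =
    \sum_(z : P) 1 + \sum_z (mid z : nat).
  by rewrite !sum_pred1 !sum_collinear card_mid sum1P; lia.
rewrite -!big_split /=; apply: eq_bigr => z _.
rewrite /far /mid ![_ == z]eq_sym.
have [->|zx] := eqVneq z x.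
  by rewrite collinearxx !(negPf xy) collinear_sym (negPf xNy).
have [->|zy] := eqVneq z y; first by rewrite collinearxx (negPf xNy).
by case: (collinear x z); case: (collinear y z).
Qed.

(** Of the [s * (t + 1)] neighbours of [c], those on the lines joining [c] to [x] and to [y], [s] on
    each, are the ones that are not far. *)
Let far_mid c : mid c -> \sum_z (far z * collinear c z) = s * t.-1.
Proof.
move=> /andP[xc yc].
have Ncx := sum_collinear2 (proj1 (andP xc)); rewrite xc in Ncx.
have Ncy := sum_collinear2 (proj1 (andP yc)); rewrite yc in Ncy.
suff : \sum_z (collinear c z : nat) = \sum_z (far z * collinear c z) +
    \sum_z (z == x : nat) + \sum_z (z == y : nat) +
    \sum_z (collinear x z * collinear c z) + \sum_z (collinear y z * collinear c z).
  by rewrite sum_collinear !sum_pred1; lia.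
rewrite -!big_split /=; apply: eq_bigr => z _.
rewrite /far ![_ == z]eq_sym.
have [->|zx] := eqVneq z x.
  by rewrite collinearxx !(negPf xy) collinear_sym xc /= collinear_sym (negPf xNy).
have [->|zy] := eqVneq z y.
  by rewrite collinearxx collinear_sym yc /= (negPf xNy).
case cz: (collinear c z); last by rewrite !muln0.
case xz: (collinear x z); case yz: (collinear y z) => //.
by have /negP[] := xNy; apply: (@collinear_no_diamond x y c z).
Qed.

(** Distinct [c] and [d] in [mid] are not collinear, so they have [t + 1] common neighbours; all but
    [x] and [y] are far. *)
Let far_mid2 c d : mid c -> mid d -> c != d ->
  \sum_z (far z * (collinear c z * collinear d z)) = t.-1.
Proof.
move=> /andP[xc yc] /andP[xd yd] cd.
have cNd : ~~ collinear c d.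
  by apply: contra xNy => ?; apply: (@collinear_no_diamond x y c d).
have := sum_collinear2 cd; rewrite (negPf cNd) !muln0 !addn0.
suff -> : \sum_z (collinear c z * collinear d z) =
    \sum_z (far z * (collinear c z * collinear d z)) +
    \sum_z (z == x : nat) + \sum_z (z == y : nat) by rewrite !sum_pred1; lia.
rewrite -!big_split /=; apply: eq_bigr => z _.
rewrite /far ![_ == z]eq_sym.
have [->|zx] := eqVneq z x.
  by rewrite (negPf xy) ![collinear _ x]collinear_sym xc xd.
have [->|zy] := eqVneq z y.
  by rewrite ![collinear _ y]collinear_sym yc yd.
case cz: (collinear c z); last by rewrite !muln0.
case dz: (collinear d z); last by rewrite !muln0.
case xz: (collinear x z).
  rewrite (@collinear_no_diamond c d x z) // in cNd; by rewrite collinear_sym.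
case yz: (collinear y z) => //.
by rewrite (@collinear_no_diamond c d y z) // in cNd; rewrite collinear_sym.
Qed.

(* With [n z] the number of points collinear with [x], [y] and [z], this is the
   Cauchy-Schwarz inequality for [n] on the points [z] far from [x] and [y]. *)
Lemma higman_of_non_collinear : t <= s ^ 2.
Proof.
pose n z := \sum_c (mid c * collinear c z).
pose S1 := \sum_z far z * n z; pose S2 := \sum_z far z * n z ^ 2.
have S1E : S1 = t.+1 * (s * t.-1).
  transitivity (\sum_c mid c * \sum_z far z * collinear c z).
    rewrite /S1 /n; under eq_bigr => z _ do rewrite big_distrr /=.
    rewrite exchange_big /=; apply: eq_bigr => c _.
    by rewrite big_distrr /=; apply: eq_bigr => z _; rewrite mulnCA.
  rewrite -card_mid big_distrl /=; apply: eq_bigr => c _.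
  by case mc: (mid c) => //; rewrite far_mid.
(* Count triples [(z, c, d)]: for each [c], the case [d = c] gives [s * (t - 1)] and each of the [t]
   others gives [t - 1]. *)
have S2E : S2 = t.+1 * (s * t.-1 + t * t.-1).
  transitivity (\sum_c mid c * \sum_d mid d *
      \sum_z far z * (collinear c z * collinear d z)).
    rewrite /S2 /n.
    under eq_bigr => z _.
      rewrite -mulnn big_distrl big_distrr /=.
      under eq_bigr => c _ do rewrite big_distrr big_distrr /=.
      over.
    rewrite exchange_big /=; apply: eq_bigr => c _.
    rewrite exchange_big big_distrr /=; apply: eq_bigr => d _.
    by rewrite big_distrr big_distrr /=; apply: eq_bigr => z _; ring.
  rewrite -card_mid big_distrl /=; apply: eq_bigr => c _.
  case mc: (mid c) => //; rewrite !mul1n (bigD1 c) //= mc mul1n; congr (_ + _).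
    rewrite -(far_mid mc); apply: eq_bigr => z _.
    by case: (collinear c z); rewrite ?muln1 ?muln0.
  rewrite (eq_bigr (fun d => mid d * t.-1)) => [|d dc]; last first.
    by case md: (mid d) => //; rewrite far_mid2 // eq_sym.
  have := card_mid; rewrite (bigD1 c) //= mc add1n => -[mid'].
  by rewrite -big_distrl /= mid'.
(* Sum [2 * (n z * n w) <= n z ^ 2 + n w ^ 2] over pairs of far points. *)
have CS : 2 * (S1 * S1) <= 2 * ((\sum_z far z) * S2).
  have dist (f g : P -> nat) : (\sum_z f z) * (\sum_w g w) = \sum_z \sum_w f z * g w.
    by rewrite big_distrl; apply: eq_bigr => z _; rewrite big_distrr.
  rewrite [X in _ <= X]mul2n -addnn {2}[(\sum_z far z) * S2]mulnC /S1 /S2.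
  rewrite !dist -big_split big_distrr /=.
  apply: leq_sum => z _; rewrite -big_split big_distrr /=; apply: leq_sum => w _.
  case: (far z); case: (far w); rewrite ?mul1n ?muln1 ?muln0 //.
  by rewrite addnC nat_Cauchy.
move: CS card_far; rewrite S1E S2E (gq_point_count x).
move: (\sum_z far z) => M; case: t t_gt1 => // u u_gt0 CS ME; rewrite /= in CS.
have {}CS : u.+2 * s ^ 2 * u <= M * (s + u.+1).
  have pos : 0 < 2 * (u.+2 * u) by rewrite !muln_gt0.
  rewrite -(leq_pmul2l pos).
  by move: CS; apply: etrans; congr (_ <= _); ring.
rewrite leqNgt; apply/negP => lt_s2t.
case: s s_gt1 lt_s2t ME CS => // r r_gt0 lt_s2t ME CS.
(* With [t = u + 1] and [s = r + 1], [d + 1] is [t - s ^ 2]; the left side of [CS] exceeds the right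
   by [t * (s - 1) * (t - s ^ 2)]. *)
have [d uE] : exists d, u = r ^ 2 + 2 * r + d.+1.
  by exists (u - (r ^ 2 + 2 * r + 1)); lia.
have : M = r ^ 4 + 3 * r ^ 3 + 4 * r ^ 2 + 2 * r + (r ^ 2 + r + 1) * d.+1.
  apply: (@addIn (2 + 2 * (r.+1 * u.+2))); rewrite addnA ME uE; ring.
move=> ME'; have : u.+2 * r.+1 ^ 2 * u = M * (r.+1 + u.+1) + u.+1 * (r * d.+1).
  by rewrite ME' uE; ring.
by have : 0 < u.+1 * (r * d.+1); [rewrite !muln_gt0; lia | lia].
Qed.

End NonCollinearPair.

(** If all other points were collinear with [x], the point count would give
    [1 + s * (t + 1) = (s + 1) * (s * t + 1)], which is impossible. *)
Lemma higman_inequality : P -> t <= s ^ 2.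
Proof.
move=> x; have [|all_col] := boolP [exists y, (x != y) && ~~ collinear x y].
  by case/existsP=> y /andP[xy xNy]; apply: higman_of_non_collinear xy xNy.
suff : \sum_y (collinear x y : nat) + \sum_y (y == x : nat) = \sum_(y : P) 1.
  have -> : \sum_(y : P) 1 = #|P| by rewrite sum1_card.
  by rewrite sum_collinear sum_pred1 (gq_point_count x); nia.
rewrite -big_split; apply: eq_bigr => y _ /=.
move/existsPn/(_ y): all_col; rewrite eq_sym.
by have [->|] := eqVneq y x; [rewrite collinearxx | rewrite negbK => _ ->].
Qed.

End QuadrangleAxioms.

(** * The line subgroups *)

Lemma orbit_size_of_higman s t q k : 1 < s -> t <= s ^ 2 ->
  q * (1 + s * k) = 1 + s * t -> s.+1 %| 1 + s * k -> q != 1 ->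
  q * s.+1 = 1 + s * t.
Proof.
move=> s_gt1 higman qk /dvdnP[e ke] q1.
have eE : e = 1 + s * (k - e) by nia.
have qE : q = 1 + s * (t - q * k) by nia.
suff ke0 : k - e = 0 by rewrite -qk ke eE ke0; lia.
apply/eqP; rewrite -leqn0 leqNgt; apply/negP=> ke_gt0.
have e_gt : s < e by rewrite eE; nia.
have q_gt : s < q by rewrite qE in q1 *; nia.
have : s.+1 * (s.+1 * s.+1) <= 1 + s * s ^ 2.
  rewrite (@leq_trans (1 + s * t)) ?leq_add2l ?leq_mul2l ?higman ?orbT //.
  by rewrite -qk ke leq_mul // leq_mul.
nia.
Qed.

(** With [u = t - q], the remainder [u + 1] is smaller than [q = 1 + s * u]. *)
Lemma orbit_size_ndvd s t q : 1 < s -> 1 < t -> q * s.+1 = 1 + s * t ->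
  ~ q %| t.+1.
Proof.
move=> s_gt1 t_gt1 qE; have tE : t = q + (t - q) by nia.
have qE' : q = 1 + s * (t - q) by nia.
rewrite tE -addnS dvdn_addr // => /dvdn_leq.
by move: (t - q) qE' tE => u; nia.
Qed.

Section LineGroups.

Local Open Scope group_scope.

Variables (gT : finGroupType) (T : {group gT}) (s t : nat).
(* [lines] stands for the lines through the identity. *)
Variable lines : {set {group gT}}.
Hypotheses (s_gt1 : (1 < s)%N) (t_gt1 : (1 < t)%N).
Hypothesis lines_sub : forall A, A \in lines -> A \subset T.
Hypothesis card_line : forall A, A \in lines -> #|A| = s.+1.
Hypothesis card_lines : #|lines| = t.+1.
Hypothesis lines_conj : forall A x, A \in lines -> x \in T -> (A :^ x)%G \in lines.
Hypothesis lines_TI : forall A B x, A \in lines -> B \in lines -> A != B ->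
  x \in A -> x \in B -> x = 1.
(** The points [1], [a], [a * b] have their sides on the lines [A], [a * B] and [C]. *)
Hypothesis lines_no_triangle : forall A B C a b,
  A \in lines -> B \in lines -> C \in lines -> A != B ->
  a \in A -> b \in B -> a * b \in C -> a = 1 \/ b = 1.
Hypothesis lines_cover : forall A x, A \in lines -> x \in T ->
  exists a B, [/\ a \in A, B \in lines & a^-1 * x \in B].

Lemma card_lineD1 A : A \in lines -> #|A^#| = s.
Proof.
by move=> lA; have := cardsD1 1 A; rewrite group1 (card_line lA) add1n => -[<-].
Qed.

Definition commuting_lines (A : {group gT}) :=
  [set B in lines | (B != A) && (B \subset 'C(A))].

(** Lines meet only in 1, so removing 1 from each makes the union disjoint. *)
Definition star (S : {set {group gT}}) : {set gT} := 1 :|: \bigcup_(B in S) B^#.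

Lemma mem_star (S : {set {group gT}}) x : S \subset lines ->
  reflect (x = 1 \/ exists2 B, B \in S & x \in B) (x \in star S).
Proof.
move=> sS; apply: (iffP setUP) => -[].
- by move/set1P; left.
- by case/bigcupP=> B SB /setD1P[_ xB]; right; exists B.
- by move->; left; rewrite set11.
case=> B SB xB; have [->|x1] := eqVneq x 1; first by left; rewrite set11.
by right; apply/bigcupP; exists B => //; rewrite in_setD1 x1.
Qed.

Lemma card_star (S : {set {group gT}}) :
  S \subset lines -> #|star S| = (1 + s * #|S|)%N.
Proof.
move=> sS; rewrite /star cardsU (_ : _ :&: _ = set0) ?cards0 ?subn0 ?cards1; last first.
  apply/setP=> x; rewrite !inE; apply/negP=> /andP[/eqP-> /bigcupP[B _]].
  by rewrite setD11.
congr (1 + _)%N; have inj : {in S &, injective (fun B : {group gT} => B^#)}.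
  move=> B C SB SC /= eqBC; apply/eqP/negPn/negP => BC.
  have: (0 < #|B^#|)%N.
    by rewrite (card_lineD1 (subsetP sS _ SB)) ltnW.
  case/card_gt0P=> x Bx; have Cx := Bx; rewrite eqBC in Cx.
  case/setD1P: Bx => x1 Bx; case/setD1P: Cx => _ Cx; case/eqP: x1.
  by apply: (lines_TI _ _ BC Bx Cx); apply: (subsetP sS).
have tiS : trivIset [set B^# | B : {group gT} in S].
  apply/trivIsetP=> _ _ /imsetP[B SB ->] /imsetP[C SC ->] BC.
  rewrite -setI_eq0; apply/eqP/setP=> x; rewrite !inE; apply/negP.
  case/andP=> /andP[/eqP x1 Bx] /andP[_ Cx]; apply: x1.
  have {}BC : B != C by apply: contraNneq BC => ->.
  by apply: (lines_TI _ _ BC Bx Cx); apply: (subsetP sS).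
have -> : \bigcup_(B in S) B^# = cover [set B^# | B : {group gT} in S].
  by rewrite cover_imset.
rewrite -(eqP tiS) big_imset //= (eq_bigr (fun=> s)) ?sum_nat_const 1?mulnC // => B SB.
exact: card_lineD1 (subsetP sS _ SB).
Qed.

(** Apply the triangle hypothesis to [(a'^-1 * a) * b = c]. Allowing [C = A] covers a trivial second
    factor. *)
Lemma lines_decomp_inj A B C a a' b c : A \in lines -> B \in lines -> C \in lines ->
  B != A -> a \in A -> a' \in A -> b \in B -> c \in C -> b != 1 ->
  a * b = a' * c -> a = a'.
Proof.
move=> lA lB lC BA Aa Aa' Bb Cc b1 e.
have Aaa : a'^-1 * a \in A by rewrite groupM ?groupV.
have : a'^-1 * a * b \in C by rewrite -mulgA e mulKg.
case/(lines_no_triangle lA lB lC _ Aaa Bb); first by rewrite eq_sym.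
  by move/eqP; rewrite -eq_invg_mul invgK => /eqP.
by move/eqP: b1.
Qed.

Lemma card_mul_star A (S : {set {group gT}}) : A \in lines -> S \subset lines :\ A ->
  #|A * star S| = (s.+1 * (1 + s * #|S|))%N.
Proof.
move=> lA sSA; have [nAS sS] : A \notin S /\ S \subset lines.
  by move: sSA; rewrite subsetD1 => /andP[-> ->].
rewrite -(card_line lA) -card_star // -cardsX.
have -> : A * star S = [set p.1 * p.2 | p in setX A (star S)].
  apply/setP=> x; apply/mulsgP/imsetP => [[a u Aa Su ->]|[[a u] /setXP[Aa Su] ->]].
    by exists (a, u) => //; apply/setXP.
  by exists a u.
have lineS B : B \in S -> B \in lines /\ B != A.
  by move=> SB; split; [apply: (subsetP sS) | apply: contraNneq nAS => <-].
have inj a a' u u' : a \in A -> a' \in A -> u \in star S -> u' \in star S ->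
    u != 1 -> a * u = a' * u' -> a = a'.
  move=> Aa Aa' Su Su' u1 e.
  case: (mem_star _ sS Su) => [/eqP|[B /lineS[lB BA] Bu]]; first by rewrite (negPf u1).
  case: (mem_star _ sS Su') => [u'1|[C /lineS[lC _] Cu']].
    by apply: (lines_decomp_inj lA lB lA BA Aa Aa' Bu (group1 A) u1); rewrite e u'1.
  exact: (lines_decomp_inj lA lB lC BA Aa Aa' Bu Cu' u1 e).
rewrite card_in_imset // => -[a u] [a' u'] /setXP[Aa Su] /setXP[Aa' Su'] /= e.
suff aa' : a = a' by move: e; rewrite aa' => /mulgI->.
have [u1|u1] := eqVneq u 1; last exact: inj u1 e.
have [u'1|u'1] := eqVneq u' 1; last exact/esym/(inj _ _ _ _ Aa' Aa Su' Su u'1).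
by move: e; rewrite u1 u'1 !mulg1.
Qed.

(** A nontrivial [a] fixed by [x] lies in both [A] and [A :^ x], which must then coincide. *)
Lemma cent_line_norm A a : A \in lines -> a \in A -> a != 1 -> 'C_T[a] \subset 'N(A).
Proof.
move=> lA Aa a1; apply/subsetP=> x /setIP[Tx /cent1P cx].
apply/normP; apply/eqP; have := lines_conj lA Tx => lAx.
have [/(congr1 val)/= ->//|ne] := eqVneq (A :^ x)%G A.
have /conjg_fixP ax : [~ a, x] == 1 by apply/commgP/commute_sym.
have aAx : a \in (A :^ x)%G by rewrite -{1}ax /= memJ_conjg.
by case/eqP: a1; apply: lines_TI lAx lA ne aAx Aa.
Qed.

(** The two factorisations [a * b = (a ^ b) * (b ^ (a ^ b))] must agree in their first factor. *)
Lemma line_norm_cent A B b : A \in lines -> B \in lines -> B != A ->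
  b \in B -> b \in 'N(A) -> b \in 'C(A).
Proof.
move=> lA lB BA Bb nAb; have [->|b1] := eqVneq b 1; first exact: group1.
apply/centP=> a Aa; apply/esym/commgP/conjg_fixP.
have Aab : a ^ b \in A by rewrite memJ_norm.
have TA := subsetP (lines_sub lA).
have Bab : b ^ (a ^ b) \in (B :^ (a ^ b))%G by rewrite /= memJ_conjg.
apply/esym/(lines_decomp_inj lA lB (lines_conj lB (TA _ Aab)) BA Aa Aab Bb Bab b1).
by rewrite -conjgC -conjgC.
Qed.

(** One commuting pair suffices: [b] normalises, hence centralises, [A]; then every [x] in [A]
    commutes with [b], so it normalises, hence centralises, [B]. *)
Lemma commuting_lines_of A B a b : A \in lines -> B \in lines -> B != A ->
  a \in A -> a != 1 -> b \in B -> b != 1 -> b \in 'C[a] -> B \in commuting_lines A.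
Proof.
move=> lA lB BA Aa a1 Bb b1 cab; rewrite !inE lB BA /=.
have TA := subsetP (lines_sub lA); have TB := subsetP (lines_sub lB).
have cAb : b \in 'C(A).
  apply: (line_norm_cent lA lB) => //.
  by rewrite (subsetP (cent_line_norm lA Aa a1)) // inE TB.
rewrite centsC; apply/subsetP=> x Ax.
apply: (line_norm_cent lB lA) => //; first by rewrite eq_sym.
rewrite (subsetP (cent_line_norm lB Bb b1)) // inE TA //=.
by apply/cent1P/commute_sym/(centP cAb).
Qed.

Lemma commuting_lines_sub A : commuting_lines A \subset lines :\ A.
Proof. by apply/subsetP=> B; rewrite !inE => /and3P[-> ->]. Qed.

Lemma lines_decomp A : A \in lines -> T = A * star (lines :\ A) :> {set gT}.
Proof.
move=> lA; have sL : lines :\ A \subset lines by apply: subD1set.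
apply/setP=> x; apply/idP/mulsgP => [Tx|[a u Aa /(mem_star _ sL) Su ->]].
  have [a [B [Aa lB Bax]]] := lines_cover lA Tx.
  have [BA|BA] := eqVneq B A.
    exists x 1; rewrite ?mulg1 //; last by apply/(mem_star _ sL); left.
    by rewrite -(mulKVg a x) groupM // -BA.
  exists a (a^-1 * x); rewrite ?mulKVg //; apply/(mem_star _ sL); right.
  by exists B => //; apply/setD1P.
apply: groupM; first exact: subsetP (lines_sub lA) _ Aa.
by case: Su => [->|[B /setD1P[_ /lines_sub/subsetP sBT]]] //; apply: sBT.
Qed.

(** If [a * u] normalises [A], so does [u], which then centralises [A]; hence the line of a
    nontrivial [u] commutes with [A]. *)
Lemma norm_line A : A \in lines -> 'N_T(A) = A * star (commuting_lines A).
Proof.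
move=> lA; have sL : lines :\ A \subset lines by apply: subD1set.
have sC := subset_trans (commuting_lines_sub A) sL.
have TA := subsetP (lines_sub lA); have nAA := subsetP (normG A).
apply/setP=> x; apply/setIP/mulsgP => [[]|[a u Aa /(mem_star _ sC) Su ->]].
  rewrite {1}(lines_decomp lA) => /mulsgP[a u Aa /(mem_star _ sL) Su ->] nAau.
  exists a u => //; apply/(mem_star _ sC).
  case: Su => [|[B /setD1P[BA lB] Bu]]; first by left.
  have [|u1] := eqVneq u 1; [by left | right].
  have nAu : u \in 'N(A) by rewrite -(mulKg a u) groupM // groupV nAA.
  have cAu := line_norm_cent lA lB BA Bu nAu.
  have /card_gt0P[a' /setD1P[a'1 Aa']] : (0 < #|A^#|)%N by rewrite card_lineD1 // ltnW.
  exists B => //; apply: (commuting_lines_of lA lB BA Aa' a'1 Bu u1).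
  by apply/cent1P/(centP cAu).
case: Su => [->|[B /setIdP[lB /andP[_ cAB]] Bu]]; first by rewrite mulg1 TA // nAA.
have TB := subsetP (lines_sub lB); have nAB := subsetP (subset_trans cAB (cent_sub A)).
by rewrite !groupM ?(TA a) ?(TB u) ?(nAA a) ?(nAB u).
Qed.

Lemma card_norm_line A : A \in lines ->
  #|'N_T(A)| = (s.+1 * (1 + s * #|commuting_lines A|))%N.
Proof.
by move=> lA; rewrite norm_line // card_mul_star // commuting_lines_sub.
Qed.

Lemma card_lines_group : #|T| = (s.+1 * (1 + s * t))%N.
Proof.
have /card_gt0P[A lA] : (0 < #|lines|)%N by rewrite card_lines.
rewrite {1}(lines_decomp lA) card_mul_star //.
by have := cardsD1 A lines; rewrite lA card_lines add1n => /succn_inj<-.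
Qed.

Lemma card_line_orbit A : A \in lines ->
  (#|orbit 'JG T A| * (1 + s * #|commuting_lines A|))%N = (1 + s * t)%N.
Proof.
move=> lA; apply/eqP; rewrite -(@eqn_pmul2l s.+1) // -card_lines_group mulnCA.
by rewrite -card_norm_line // card_orbit astab1JG mulnC Lagrange // subsetIl.
Qed.

Lemma line_orbit_sub A : A \in lines -> orbit 'JG T A \subset lines.
Proof.
by move=> lA; apply/subsetP=> _ /orbitP[x Tx <-]; apply: lines_conj.
Qed.

(* [A * B] is a subgroup of ['N_T(A)] of order [s.+1 ^ 2]. *)
Lemma dvdn_commuting_lines A : A \in lines ->
  s.+1 %| 1 + s * #|commuting_lines A|.
Proof.
move=> lA; have : (0 < #|commuting_lines A|)%N.
  (* With no commuting line the class would have [1 + s * t] members, more than the [t + 1]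
     lines. *)
  rewrite lt0n; apply: contraTneq (subset_leq_card (line_orbit_sub lA)) => k0.
  by have := card_line_orbit lA; rewrite k0 card_lines; nia.
case/card_gt0P=> B CB; have := CB; rewrite !inE => /and3P[lB BA cAB].
rewrite -(@dvdn_pmul2l s.+1) // -card_norm_line //.
have <- : #|A <*> B| = (s.+1 * s.+1)%N.
  rewrite cent_joinEr // TI_cardMg ?card_line //.
  apply/trivgP/subsetP=> x /setIP[Ax Bx]; rewrite inE.
  by rewrite (lines_TI lB lA BA Bx Ax).
apply: cardSg; rewrite join_subG !subsetI !lines_sub // normG /=.
exact: subset_trans cAB (cent_sub A).
Qed.

Hypothesis higman : (t <= s ^ 2)%N.
Hypothesis lines_not_normal : forall A, A \in lines -> ~~ (T \subset 'N(A)).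

(** Higman's bound forces all classes to have the same size, which would then divide [t + 1]. *)
Lemma line_orbits_false : False.
Proof.
have actsL : [acts T, on lines | 'JG].
  apply/actsP=> x Tx A; apply/idP/idP => [lAx|lA]; last exact: lines_conj.
  by rewrite -(actK 'JG x A); apply: lines_conj; rewrite ?groupV.
have [A lA] : exists A, A \in lines by apply/card_gt0P; rewrite card_lines.
pose q := #|orbit 'JG T A|.
have orbitE B : B \in lines -> (#|orbit 'JG T B| * s.+1 = 1 + s * t)%N.
  move=> lB; apply: (orbit_size_of_higman s_gt1 higman (card_line_orbit lB)).
    exact: dvdn_commuting_lines.
  (* A class of size 1 would be a normal line subgroup. *)
  apply: contra (lines_not_normal lB) => /eqP/esym orb1.
  have : #|T : 'N_T(B)| = 1%N by rewrite -astab1JG -card_orbit.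
  by move/eqP; rewrite indexg_eq1 subsetI => /andP[].
apply: (orbit_size_ndvd s_gt1 t_gt1 (orbitE A lA)).
rewrite -card_lines -(acts_sum_card_orbit actsL) dvdn_sum // => _ /imsetP[B lB ->].
suff -> : #|orbit 'JG T B| = #|orbit 'JG T A| by [].
by apply/eqP; rewrite -(@eqn_pmul2r s.+1) // !orbitE.
Qed.

End LineGroups.

(** * Lines through the identity are subgroups *)

Section BiregularQuadrangle.

Local Open Scope group_scope.

Variables (P L : finType) (I : P -> L -> bool) (s t : nat).
Hypotheses (gq : generalized_quadrangle I s t) (s_gt1 : (1 < s)%N) (t_gt1 : (1 < t)%N).
Variables (gT : finGroupType) (T : {group gT}) (pt : gT -> P).
Hypothesis pt_inj : {in T &, injective pt}.
Hypothesis pt_surj : forall p, exists2 x, x \in T & pt x = p.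
Hypothesis mul_line : forall x y l, x \in T -> y \in T ->
  exists m, forall z, z \in T -> I (pt (x * z * y)) m = I (pt z) l.

Definition line_set l := [set x in T | I (pt x) l].

Lemma card_line_set l : #|line_set l| = s.+1.
Proof.
case: gq => _ _ cl _; rewrite -(cl l).
have -> : [set p | I p l] = pt @: line_set l.
  apply/setP=> p; rewrite inE; apply/idP/imsetP => [pl|[x]].
    by have [x Tx xp] := pt_surj p; exists x; rewrite // inE Tx xp.
  by rewrite inE => /andP[_ xl] ->.
by rewrite card_in_imset // => x y /setIdP[Tx _] /setIdP[Ty _]; apply: pt_inj.
Qed.

Lemma pt_neq x y : x \in T -> y \in T -> x != y -> pt x != pt y.
Proof. by move=> Tx Ty; apply: contra_neq; apply: pt_inj. Qed.

(* For [z] on [l] other than [1] and [g], the points [z], [g], [z * g] are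
   pairwise collinear, so the line [l * g] coincides with [l]. *)
Lemma group_line_set l : I (pt 1) l -> group_set (line_set l).
Proof.
move=> l1; apply/group_setP; split=> [|z g]; first by rewrite inE group1.
case/setIdP=> Tz zl /setIdP[Tg gl].
have [g1|g1] := eqVneq g 1; first by rewrite g1 mulg1 inE Tz.
have [m lm] := mul_line l (group1 T) Tg.
suff ml : l = m.
  by rewrite inE groupM //=; have := lm z Tz; rewrite mul1g zl -ml.
have [y] : exists y, y \in line_set l :\: [set 1; g].
  apply/card_gt0P; rewrite cardsD card_line_set subn_gt0.
  apply: leq_ltn_trans (subset_leq_card (subsetIr _ _)) _.
  by rewrite cards2; case: (1 != g); lia.
rewrite !inE negb_or => /andP[/andP[y1 yg] /andP[Ty yl]].
(* [m] is the line [l * g] and [n] is [y * l]; they join [y * g] to [g] and to [y]. *)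
have [n ln] := mul_line l Ty (group1 T).
have Tyg : y * g \in T by rewrite groupM.
have gm : I (pt g) m by have := lm 1 (group1 T); rewrite !mul1g l1.
have ygm : I (pt (y * g)) m by have := lm y Ty; rewrite mul1g yl.
have yn : I (pt y) n by have := ln 1 (group1 T); rewrite !mulg1 l1.
have ygn : I (pt (y * g)) n by have := ln g Tg; rewrite mulg1 gl.
apply: (gq_no_triangle gq _ _ _ yl gl gm ygm ygn yn); apply: pt_neq => //.
  by rewrite -{1}(mul1g g) (inj_eq (mulIg g)) eq_sym.
by rewrite -{1}(mulg1 y) (inj_eq (mulgI y)) eq_sym.
Qed.

(** Generation makes this a group for every [l]; for [l] through 1 it adds nothing. *)
Definition line_group l : {group gT} := <<line_set l>>%G.

Definition line_groups : {set {group gT}} :=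
  [set line_group l | l in [set l | I (pt 1) l]].

Lemma mem_line_group l x : I (pt 1) l -> (x \in line_group l) = (x \in T) && I (pt x) l.
Proof.
move=> l1; rewrite /= (gen_set_id (group_line_set l1)); exact: in_set.
Qed.

Lemma line_groupP A :
  reflect (exists2 l, I (pt 1) l & A = line_group l) (A \in line_groups).
Proof.
by apply: (iffP imsetP) => -[l l1 ->]; exists l; rewrite // inE in l1 *.
Qed.

Lemma line_eq x y l m : x \in T -> y \in T -> x != y ->
  I (pt x) l -> I (pt y) l -> I (pt x) m -> I (pt y) m -> l = m.
Proof. by move=> Tx Ty xy; apply: (gq_line_unique gq); apply: pt_neq. Qed.

Lemma card_line_group l : I (pt 1) l -> #|line_group l| = s.+1.
Proof. by move=> l1; rewrite /= (gen_set_id (group_line_set l1)) card_line_set. Qed.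

Lemma card_line_groups : #|line_groups| = t.+1.
Proof.
case: gq => _ _ _ cp; rewrite -(cp (pt 1)) card_in_imset // => l m.
rewrite !inE => l1 m1 eqlm.
have /card_gt0P[x] : (0 < #|(line_group l)^#|)%N.
  have := cardsD1 1 (line_group l); rewrite group1 card_line_group // add1n => -[<-].
  by apply: ltnW.
case/setD1P=> x1 xl; have xm := xl; rewrite eqlm in xm.
move: xl xm; rewrite !mem_line_group // => /andP[Tx xl] /andP[_ xm].
exact: line_eq Tx (group1 T) x1 xl l1 xm m1.
Qed.

(** Conjugation is a two-sided translation fixing 1. *)
Lemma line_groups_conj A x : A \in line_groups -> x \in T -> (A :^ x)%G \in line_groups.
Proof.
case/line_groupP=> l l1 -> Tx; have [m lm] := mul_line l (groupVr Tx) Tx.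
have m1 : I (pt 1) m by have := lm 1 (group1 T); rewrite mulg1 mulVg l1.
apply/line_groupP; exists m => //; apply/group_inj/setP=> z.
rewrite -[LHS]/(z \in line_group l :^ x) mem_conjg !mem_line_group //.
rewrite groupJr ?groupV //.
case Tz: (z \in T) => //=; rewrite -lm ?groupJ ?groupV // conjgE invgK.
by rewrite !mulgA mulVg mul1g mulgKV.
Qed.

Lemma line_groups_TI A B x : A \in line_groups -> B \in line_groups -> A != B ->
  x \in A -> x \in B -> x = 1.
Proof.
case/line_groupP=> l l1 ->; case/line_groupP=> m m1 -> lm.
rewrite !mem_line_group // => /andP[Tx xl] /andP[_ xm]; apply/eqP.
apply: contraNT lm => x1; apply/eqP; congr line_group.
exact: line_eq Tx (group1 T) x1 xl l1 xm m1.
Qed.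

Lemma line_groups_no_triangle A B C a b :
  A \in line_groups -> B \in line_groups -> C \in line_groups -> A != B ->
  a \in A -> b \in B -> a * b \in C -> a = 1 \/ b = 1.
Proof.
move=> lA lB lC AB Aa Bb Cab.
have [|a1] := eqVneq a 1; [by left | right; apply/eqP; apply: contraNT AB => b1].
case/line_groupP: lC Cab => n n1 ->; case/line_groupP: lA lB Aa => l l1 -> lB.
case/line_groupP: lB Bb => m m1 ->; rewrite !mem_line_group //.
move=> /andP[Tb bm] /andP[Ta al] /andP[Tab abn].
have [ab1|ab1] := eqVneq (a * b) 1.
  have bl : b \in line_group l.
    by rewrite -(mulKg a b) ab1 mulg1 groupV mem_line_group ?Ta.
  rewrite mem_line_group // in bl; case/andP: bl => _ bl.
  by apply/eqP; congr line_group; apply: line_eq Tb (group1 T) b1 bl l1 bm m1.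
(* [m'] is [a * m], joining [a] to [a * b]; the triangle [1], [a], [a * b] forces it to be [l], so
   [b] lies on [l]. *)
have [m' mm'] := mul_line m Ta (group1 T).
have am' : I (pt a) m' by have := mm' 1 (group1 T); rewrite !mulg1 m1.
have abm' : I (pt (a * b)) m' by have := mm' b Tb; rewrite mulg1 bm.
have lm' : l = m'.
  apply: (gq_no_triangle gq _ _ _ l1 al am' abm' abn n1).
  - by apply: pt_neq; rewrite // eq_sym.
  - by apply: pt_neq; rewrite // -{1}(mulg1 a) (inj_eq (mulgI a)) eq_sym.
  by apply: pt_neq; rewrite // eq_sym.
have bl : b \in line_group l.
  have abl : I (pt (a * b)) l by rewrite lm'.
  by rewrite -(mulKg a b) groupM // ?groupV mem_line_group // ?Ta ?Tab.
rewrite mem_line_group // in bl; case/andP: bl => _ bl.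
by apply/eqP; congr line_group; apply: line_eq Tb (group1 T) b1 bl l1 bm m1.
Qed.

(** Project [x] on the line of [A] to get [a], then translate the joining line by [a^-1]. *)
Lemma line_groups_cover A x : A \in line_groups -> x \in T ->
  exists a B, [/\ a \in A, B \in line_groups & a^-1 * x \in B].
Proof.
case/line_groupP=> l l1 -> Tx.
have [q [m [ql xm qm]]] : exists q m, [/\ I q l, I (pt x) m & I q m].
  have [xl|xl] := boolP (I (pt x) l); last exact: (gq_projection gq xl).
  by exists (pt 1), l.
have [a Ta aq] := pt_surj q; rewrite -aq in ql qm.
have [n mn] := mul_line m (groupVr Ta) (group1 T).
have n1 : I (pt 1) n by have := mn a Ta; rewrite mulVg mulg1 qm.
exists a, (line_group n); rewrite !mem_line_group // Ta groupM ?groupV //; split=> //.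
  by apply/line_groupP; exists n.
by have := mn x Tx; rewrite mulg1 xm.
Qed.

(** Simplicity excludes a normal line subgroup: its order [s + 1] is neither 1 nor [#|T|]. *)
Lemma biregular_simple_false : simple T -> False.
Proof.
move=> simT; have higman := higman_inequality gq s_gt1 t_gt1 (pt 1).
have sub A : A \in line_groups -> A \subset T.
  case/line_groupP=> l l1 ->; apply/subsetP=> x.
  by rewrite mem_line_group // => /andP[].
have card A : A \in line_groups -> #|A| = s.+1.
  by case/line_groupP=> l l1 ->; apply: card_line_group.
have cardT := card_lines_group s_gt1 sub card card_line_groups line_groups_TI
  line_groups_no_triangle line_groups_cover.
apply: (line_orbits_false s_gt1 t_gt1 sub card card_line_groups line_groups_conj
  line_groups_TI line_groups_no_triangle line_groups_cover higman).
move=> A lA; apply/negP=> nAT; have nA : A <| T by rewrite /normal sub.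
have /simpleP[_ /(_ A nA)[A1|AT]] := simT.
  by have := card A lA; rewrite A1 cards1; lia.
by have := card A lA; rewrite AT cardT; nia.
Qed.

End BiregularQuadrangle.

(** * From type HS to two-sided translations *)

Lemma on_points_line (P L : finType) (I : P -> L -> bool)
    (G : {group {perm P} * {perm L}}) (autG : G \subset Aut_incidence I) u l :
  u \in on_points G -> exists m, forall p, I (u p) m = I p l.
Proof.
case/morphimP=> -[u' h] _ Gu /= ->; exists (h l) => p.
have := subsetP autG _ Gu; rewrite inE => /forallP/(_ p)/forallP/(_ l)/eqP.
exact.
Qed.

Lemma socle_sub (gT : finGroupType) (G : {group gT}) : socle G \subset G.
Proof.
rewrite gen_subG; apply/bigcupsP=> N /andP[_]; apply: normal_sub.
Qed.

Theorem theorem4p1 (P L : finType) (I : P -> L -> bool) (s t : nat)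
    (gq : generalized_quadrangle I s t) (s_ge2 : 2 <= s) (t_ge2 : 2 <= t)
    (G : {group {perm P} * {perm L}}) (autG : G \subset Aut_incidence I)
    (primG : [primitive on_points G, on [set: P] | 'P]) :
  ~ type_HS (on_points G).
Proof.
case=> gT [T [f [[simT _] /isomP[injf imf] _ [[transH semiH] _] [w stab_w]]]].
have mem2 x y : x \in T -> y \in T -> (x, y) \in setX T T.
  by move=> Tx Ty; apply/setXP.
have f1 x : x \in T -> f (x, 1%g) \in (f @* setX T 1)%g.
  move=> Tx; apply: mem_morphim; first exact: mem2.
  by apply/setXP; rewrite group1.
have diag y : y \in T -> f (y, y) w = w.
  move=> Ty; have : f (y, y) \in 'C_(socle (on_points G))[w | 'P]%g.
    by rewrite stab_w; apply: mem_morphim; [apply: mem2 | apply: imset_f].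
  by case/setIP=> _ /astab1P.
(* Regularity of the first factor identifies [T] with the points, 1 going to [w]. *)
pose pt x := f (x, 1%g) w.
have f_pt x y z : x \in T -> y \in T -> z \in T ->
    f (x, y) (pt z) = pt (y^-1 * z * x)%g.
  move=> Tx Ty Tz; rewrite /pt -permM -morphM ?mem2 //.
  (* As [f (y, y)] fixes [w], multiplying on the left by [(y, y)] turns [(y^-1 * z * x, 1)] into
     [(z * x, y)]. *)
  rewrite -{2}(diag y Ty) -permM -morphM ?mem2 ?groupM ?groupV //.
  by congr (f _ w); congr pair; rewrite ?mul1g ?mulg1 // -mulgA mulKVg.
apply: (@biregular_simple_false P L I s t gq s_ge2 t_ge2 gT T pt) simT.
- move=> x y Tx Ty exy; have /(injmP injf) : f (x, 1%g) = f (y, 1%g).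
    apply/eqP; rewrite eq_mulgV1 -in_set1 -[[set _]](semiH w) inE groupM ?groupV ?f1 //.
    by apply/astab1P; rewrite /= /aperm permM -/(pt x) exy -permM mulgV perm1.
  by case/(_ (mem2 _ _ Tx (group1 T)) (mem2 _ _ Ty (group1 T))).
- move=> p; have [_ /morphimP[[x y] _ /setXP[Tx /set1P->] ->] ->] :=
    atransP2 transH (in_setT w) (in_setT p).
  by exists x.
(* The pair [(y, x^-1)] acts as [z |-> x * z * y]. *)
move=> x y l Tx Ty; have Sf : f (y, x^-1)%g \in on_points G.
  apply: (subsetP (socle_sub _)); have yx := mem2 _ _ Ty (groupVr Tx).
  by have := mem_morphim f yx yx; rewrite imf.
have [m fm] := on_points_line autG l Sf; exists m => z Tz.
by rewrite -fm f_pt ?groupV // invgK.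
Qed.
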